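(* Let $(X,d)$ be a complete metric space. If a parameterized iterated function system $\mathcal{F}=\{X; f_\lambda\mid\lambda\in\Lambda\}$ on $X$ is uniformly expanding and if each function $f_\lambda$ ($\lambda\in\Lambda$) is surjective, then $\mathcal{F}$ has the weak shadowing property on $\mathbb{Z}_+$.
   Context: A parameterized iterated function system (IFS) $\mathcal{F}=\{X; f_\lambda\mid\lambda\in\Lambda\}$ on a metric space $(X,d)$ is a family of continuous maps $f_\lambda:X\to X$, $\lambda\in\Lambda$, where $\Lambda$ is a finite nonempty set. Let $\mathbb{Z}_+=\{n\in\mathbb{Z}: n\ge 0\}$. $\mathcal{F}$ is uniformly expanding if $$\alpha=\inf_{\lambda\in\Lambda}\inf_{x\neq y}\frac{d(f_\lambda(x),f_\lambda(y))}{d(x,y)}>1.$$ A sequence $\{x_n\}_{n\in\mathbb{Z}_+}$ in $X$ is an orbit of $\mathcal{F}$ if there exists $\{\lambda_n\}_{n\in\mathbb{Z}_+}\in\Lambda^{\mathbb{Z}_+}$ such that $x_{n+1}=f_{\lambda_n}(x_n)$ for all $n\in\mathbb{Z}_+$. Given $\delta>0$, a sequence $\{x_n\}_{n\in\mathbb{Z}_+}$ in $X$ is a $\delta$-pseudo orbit of $\mathcal{F}$ if there exists $\{\lambda_n\}_{n\in\mathbb{Z}_+}\in\Lambda^{\mathbb{Z}_+}$ such that $d(x_{n+1},f_{\lambda_n}(x_n))<\delta$ for all $n\in\mathbb{Z}_+$. For $S\subset X$ and $\epsilon>0$, $B_\epsilon(S)$ denotes the set of all $x\in X$ such that $d(x,S)<\epsilon$.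 $\mathcal{F}$ has the weak shadowing property on $\mathbb{Z}_+$ if for every $\epsilon>0$ there exists $\delta>0$ such that for every $\delta$-pseudo orbit $\mathbf{x}=\{x_n\}_{n\in\mathbb{Z}_+}$ of $\mathcal{F}$ there is an orbit $\mathbf{y}=\{y_n\}_{n\in\mathbb{Z}_+}$ of $\mathcal{F}$ with $\mathbf{y}\subset B_\epsilon(\mathbf{x})$ (sequences being identified with their sets of terms). *)

(* Defs.v *)
From HB Require Import structures.
From mathcomp Require Import all_boot all_order all_algebra.
From mathcomp Require Import all_classical all_reals all_analysis.

Set Implicit Arguments.
Unset Strict Implicit.
Unset Printing Implicit Defensive.

Import Order.TTheory GRing.Theory Num.Theory.

Local Open Scope classical_set_scope.
Local Open Scope ring_scope.

(* The library's [completeType] is pointed; this predicate does not require the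
   space to be inhabited. *)
Definition complete_space (X : uniformType) : Prop :=
  forall u : nat -> X, cauchy (u @ \oo) -> exists l : X, u @ \oo --> l.

Section IFS.
Context {R : realType} {X : metricType R} {Lambda : finType}.
Implicit Types (f : Lambda -> X -> X) (x : nat -> X).

(* Taken in the extended reals: when X has at most one point the inner infimum
   is over the empty set and equals +oo. *)
Definition expansion_constant f : \bar R :=
  ereal_inf [set ereal_inf
    [set (mdist (f l p.1) (f l p.2) / mdist p.1 p.2)%:E
      | p in [set p : X * X | p.1 <> p.2]]
    | l in [set: Lambda]].

Definition uniformly_expanding f : Prop := (1 < expansion_constant f)%E.

Definition is_orbit f x : Prop :=
  exists l : nat -> Lambda, forall n, x n.+1 = f (l n) (x n).

Definition is_pseudo_orbit f (delta : R) x : Prop :=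
  exists l : nat -> Lambda, forall n, mdist (x n.+1) (f (l n) (x n)) < delta.

Definition set_dist (a : X) (S : set X) : \bar R :=
  ereal_inf [set (mdist a s)%:E | s in S].

Definition set_nbhd (eps : R) (S : set X) : set X :=
  [set a | (set_dist a S < eps%:E)%E].

Definition weak_shadowing f : Prop :=
  forall eps : R, 0 < eps -> exists2 delta : R, 0 < delta &
    forall x, is_pseudo_orbit f delta x ->
      exists2 y : nat -> X, is_orbit f y & range y `<=` set_nbhd eps (range x).

End IFS.

(* Main.v *)
Require Import Defs.
From mathcomp Require Import all_boot all_order all_algebra.
From mathcomp Require Import all_classical all_reals all_analysis.
From mathcomp Require Import lra.

Import Order.TTheory GRing.Theory Num.Theory.
Import numFieldNormedType.Exports.

Local Open Scope classical_set_scope.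
Local Open Scope ring_scope.

(** The pseudo orbit is shadowed by an orbit that follows the same symbols.
Expanding surjective maps have contracting right inverses [g n].  Pulling the
point [x (k + m)] of the pseudo orbit back to time [k] through them gives a
point [pullback g x k m], and for fixed [k] this sequence in [m] is Cauchy: two
of its terms of index at least [m] arise from points near [x (k + m)] by
applying [m] contractions of ratio [a^-1], where [a > 1] is the expansion rate.
By completeness it has a limit [y k].  Each map sends the pullbacks to time [k]
to the pullbacks to time [k.+1] with one step fewer, so by continuity [y] is
an orbit.

The error is controlled by the fixed point of the pullback estimate.  If each
jump of the pseudo orbit is at most [(a - 1) * C], then a bound [C] at time
[k.+1] grows by one jump to [a * C], which pulls back to the bound [C] at time
[k].  So [C] bounds every [mdist (x k) (pullback g x k m)]
([pullback_near]), and this passes to the limit.  Taking [C] to be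
half of the required precision gives [corollary3p4]. *)

Fixpoint pullback {T : Type} (g : nat -> T -> T) (x : nat -> T) (k m : nat) : T :=
  if m is m'.+1 then g k (pullback g x k.+1 m') else x k.

(** The constant is extracted as a real number because the infimum is infinite
when the space has at most one point; any rate greater than [1] is then
suitable. *)
Lemma uniformly_expanding_rate {R : realType} {X : metricType R} {Lambda : finType}
    (f : Lambda -> X -> X) :
  uniformly_expanding f ->
  exists2 a : R, 1 < a &
    forall l p q, a * mdist p q <= mdist (f l p) (f l q).
Proof.
rewrite /uniformly_expanding => f1.
have [a a1 af] : exists2 a : R, 1 < a & (a%:E <= expansion_constant f)%E.
  case: (expansion_constant f) f1 => [r| |//].
    by rewrite lte_fin => r1; exists r.
  by exists 2; rewrite ?ltr1n ?leey.
exists a => // l p q; have [->|pq] := eqVneq p q.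
  by rewrite !mdistxx mulr0.
rewrite -ler_pdivlMr ?mdist_gt0// -lee_fin (le_trans af)//.
apply: (@le_trans _ _ (ereal_inf
    [set (mdist (f l u.1) (f l u.2) / mdist u.1 u.2)%:E
      | u in [set u : X * X | u.1 <> u.2]])).
  by apply: ereal_inf_lbound; exists l.
by apply: ereal_inf_lbound; exists (p, q) => //=; exact/eqP.
Qed.

Lemma cvg_mdist_le {R : realType} {X : metricType R} (u : nat -> X)
    (p y : X) (C : R) :
  u @ \oo --> y -> (forall n, mdist p (u n) <= C) -> mdist p y <= C.
Proof.
move=> uy uC; apply/ler_addgt0Pr => e e0.
have [N _ /(_ N (leqnn N))] := cvg_ball uy e0.
rewrite ballEmdist /= metric_sym => yuN.
by rewrite (le_trans (metric_triangle _ (u N) _))// lerD// ltW.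
Qed.

(** The maps vary with time, so that the symbols followed by a pseudo orbit are
absorbed into [F]. *)
Section expanding_shadowing.
Context {R : realType} {X : metricType R}.
Variables (F : nat -> X -> X) (a : R).
Hypotheses (a1 : 1 < a)
  (Fexp : forall n p q, a * mdist p q <= mdist (F n p) (F n q)).

Section pullback_estimates.
Variables (g : nat -> X -> X) (x : nat -> X) (C : R).
Hypotheses (gK : forall n, cancel (g n) (F n))
  (xF : forall n, mdist (x n.+1) (F n (x n)) <= (a - 1) * C).

(** Induction on the number of steps, for all starting times at once: the jump
bound is chosen so that [(a - 1) * C + C = a * C], hence one jump followed by
one contraction preserves the bound [C]. *)
Lemma pullback_near k m : 0 <= C -> mdist (x k) (pullback g x k m) <= C.
Proof.
move=> C0; elim: m k => [|m IH] k /=; first by rewrite mdistxx.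
rewrite -(ler_pM2l (lt_trans ltr01 a1)) (le_trans (Fexp k _ _))// gK.
rewrite (le_trans (metric_triangle _ (x k.+1) _))// metric_sym.
have := IH k.+1; have := xF k; lra.
Qed.

(** Both points pass through the same [m] right inverses, which contract the
distance bounded by [pullback_near]. *)
Lemma pullback_dist k m p : 0 <= C ->
  mdist (pullback g x k m) (pullback g x k (m + p)) <= C * a^-1 ^+ m.
Proof.
move=> C0; have a0 : 0 < a := lt_trans ltr01 a1.
elim: m k => [|m IH] k /=; first by rewrite expr0 mulr1 pullback_near.
rewrite -(ler_pM2l a0) (le_trans (Fexp k _ _))// !gK (le_trans (IH k.+1))//.
by rewrite exprS mulrCA mulVKf// gt_eqF.
Qed.

Lemma pullback_cauchy k : 0 <= C -> cauchy (pullback g x k @ \oo).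
Proof.
move=> C0; apply: cauchy_exP => e e0.
have a0 : 0 < a := lt_trans ltr01 a1.
have : (fun n => C * a^-1 ^+ n) @ \oo --> C * 0.
  apply: cvgMr; apply: cvg_expr.
  by rewrite ger0_norm ?invr_ge0 ?ltW// invf_lt1.
rewrite mulr0 => /cvgr0_norm_lt/(_ _ e0)[N _ Ne].
exists (pullback g x k N); exists N => // n /= Nn; rewrite ballEmdist /=.
rewrite -(subnKC Nn) (le_lt_trans (pullback_dist k N _ C0))//.
by rewrite (le_lt_trans _ (Ne N (leqnn N)))// ler_norm.
Qed.

End pullback_estimates.

Lemma expanding_shadowing (x : nat -> X) (C : R) :
  complete_space X -> (forall n, continuous (F n)) ->
  (forall n, set_surj [set: X] [set: X] (F n)) -> 0 <= C ->
  (forall n, mdist (x n.+1) (F n (x n)) <= (a - 1) * C) ->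
  exists2 y : nat -> X, forall n, y n.+1 = F n (y n) &
    forall n, mdist (x n) (y n) <= C.
Proof.
move=> Xc Fc Fs C0 xF.
have /choice[g gK] n : exists h, cancel h (F n).
  have /choice[h hK] z : exists w, F n w = z.
    by have [w _ wz] := Fs n z I; exists w.
  by exists h.
have /choice[y yP] k := Xc _ (pullback_cauchy g x C gK xF k C0).
exists y => n; last first.
  by apply: cvg_mdist_le (yP n) _ => m; exact: pullback_near.
apply: (cvg_unique (@metric_hausdorff _ _) (yP n.+1)).
(* The orbit relation already holds before the limit, with the index shifted. *)
have -> : pullback g x n.+1 = F n \o [sequence pullback g x n m.+1]_m.
  by apply/funext => m /=; rewrite gK.
apply: continuous_cvg; first exact: Fc.
exact: cvg_comp (cvg_addnl 1) (yP n).
Qed.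

End expanding_shadowing.

Theorem corollary3p4 (R : realType) (X : metricType R) (Lambda : finType)
    (f : Lambda -> X -> X)
    (Xcomplete : complete_space X)
    (Lambda_nonempty : (0 < #|Lambda|)%N)
    (fcont : forall l : Lambda, continuous (f l))
    (fexp : uniformly_expanding f)
    (fsurj : forall l : Lambda, set_surj [set: X] [set: X] (f l)) :
  weak_shadowing f.
Proof.
move=> eps eps0; have [a a1 fa] := uniformly_expanding_rate f fexp.
have e20 : 0 < eps / 2 by rewrite divr_gt0.
exists ((a - 1) * (eps / 2)) => [|x [l xl]].
  by rewrite mulr_gt0// subr_gt0.
have [y yF xy] := expanding_shadowing (f \o l) a a1 (fun n => fa (l n)) x (eps / 2)
  Xcomplete (fun n => fcont (l n)) (fun n => fsurj (l n)) (ltW e20)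
  (fun n => ltW (xl n)).
exists y; first by exists l.
move=> _ [n _ <-]; rewrite /set_nbhd/= /set_dist.
apply: (@le_lt_trans _ _ (mdist (y n) (x n))%:E).
  by apply: ereal_inf_lbound; exists (x n) => //; exists n.
by rewrite lte_fin metric_sym (le_lt_trans (xy n))// ltr_pdivrMr// ltr_pMr// ltr1n.
Qed.
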